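(* If $\mathfrak{p}=\mathrm{cof}(\mathcal{M})$, then there is a remote filter in $\omega\times{}^{\omega}2$ with a base of order type $\mathfrak{p}$ with respect to the relation $\subset^\ast$.
   Context: ${}^{\omega}2$ is the Cantor set (product topology) and $\omega\times{}^{\omega}2$ has the product topology with $\omega$ discrete. A remote filter in $\omega\times{}^{\omega}2$ is a (proper) filter $\mathcal{F}$ in the Boolean algebra of clopen subsets of $\omega\times{}^{\omega}2$ such that for every nowhere dense $N\subset\omega\times{}^{\omega}2$ there is $V\in\mathcal{F}$ with $V\cap N=\emptyset$. A base of $\mathcal{F}$ is a collection of clopen sets that generates $\mathcal{F}$ as a filter. For clopen sets $U,V$, $U\subset^\ast V$ means that $U\setminus V$ is compact. A base of order type $\mathfrak{p}$ with respect to $\subset^\ast$ is a base $\{U_\alpha:\alpha<\mathfrak{p}\}$ that is strictly decreasing modulo compact sets: for $\alpha<\beta<\mathfrak{p}$, $U_\beta\subset^\ast U_\alpha$ and not $U_\alpha\subset^\ast U_\beta$. $\mathcal{M}$ is the family of all meager subsets of ${}^{\omega}\omega$ (product topology, $\omega$ discrete), and $\mathrm{cof}(\mathcal{M})$ is the least cardinality of a family $\mathcal{G}\subset\mathcal{M}$ cofinal in $\langle\mathcal{M},\subset\rangle$. Let $[\omega]^\omega$ be the set of infinite subsets of $\omega$. A family $\mathcal{G}\subset[\omega]^\omega$ is centered if for all $G_0,\ldots,G_n\in\mathcal{G}$ there is $G\in\mathcal{G}$ with $G\subset G_0\cap\ldots\cap G_n$; a pseudointersection of $\mathcal{G}$ is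 a set $A\in[\omega]^\omega$ with $A\setminus G$ finite for all $G\in\mathcal{G}$. $\mathfrak{p}$ is the least cardinality of a centered family $\mathcal{G}\subset[\omega]^\omega$ with no pseudointersection. *)

(* Defs.v *)
From mathcomp Require Import all_boot.
From mathcomp Require Import boolp classical_sets functions cardinality.
From mathcomp Require wochoice.
From mathcomp Require Import topology cantor.

Set Implicit Arguments.
Unset Strict Implicit.
Unset Printing Implicit Defensive.

Local Open Scope classical_set_scope.
Local Open Scope card_scope.

(* A cardinal is an initial ordinal: a well-ordered type none of whose proper
   initial segments has the cardinality of the whole. The type of ordinals
   below it is [ord_below]. *)
Record cardinal := Cardinal {
  ord_below :> Type;
  ord_le : rel ord_below;
  ord_le_wo : wochoice.well_order ord_le;
  ord_le_initial : forall a : ord_below,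
    ~ ([set: ord_below] #<= [set b | ~~ ord_le a b])
}.

Definition ord_lt (kappa : cardinal) (a b : kappa) : Prop := ~~ ord_le b a.

Definition is_least_cardinality (T : Type) (P : set (set T))
    (kappa : cardinal) : Prop :=
  (exists2 G, P G & G #= [set: kappa]) /\
  (forall G, P G -> [set: kappa] #<= G).

Definition centered (G : set (set nat)) : Prop :=
  forall (n : nat) (g : nat -> set nat),
    (forall i, (i <= n)%N -> G (g i)) ->
    exists2 A, G A & A `<=` \bigcap_(i in [set i | (i <= n)%N]) g i.

Definition pseudointersection (G : set (set nat)) (A : set nat) : Prop :=
  infinite_set A /\ forall B, G B -> finite_set (A `\` B).

Definition is_pseudointersection_number (kappa : cardinal) : Prop :=
  is_least_cardinality
    [set G : set (set nat) |
      [/\ (forall A, G A -> infinite_set A), centered G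
        & ~ exists A, pseudointersection G A]]
    kappa.

Definition nowhere_dense (T : topologicalType) (N : set T) : Prop :=
  interior (closure N) = set0.

Definition meager (T : topologicalType) (A : set T) : Prop :=
  exists N : nat -> set T,
    (forall n, nowhere_dense (N n)) /\ A = \bigcup_n N n.

Definition baire_space : topologicalType := prod_topology (fun _ : nat => nat).

Definition is_cof_meager (kappa : cardinal) : Prop :=
  is_least_cardinality
    [set G : set (set baire_space) |
      (forall A, G A -> meager A) /\
      (forall A, meager A -> exists2 B, G B & A `<=` B)]
    kappa.

Section ClopenFilters.
Variable T : topologicalType.
Implicit Types (F B : set (set T)) (U V : set T).

(* Not required to be proper, so that every family of clopen sets generates
   a filter. *)
Definition clopen_filter F : Prop :=
  [/\ forall U, F U -> clopen U,
      F setT,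
      forall U V, F U -> F V -> F (U `&` V)
    & forall U V, F U -> clopen V -> U `<=` V -> F V].

Definition remote_filter F : Prop :=
  [/\ clopen_filter F,
      ~ F set0
    & forall N, nowhere_dense N -> exists2 V, F V & V `&` N = set0].

Definition filter_base F B : Prop :=
  (forall U, B U -> clopen U) /\ F = smallest clopen_filter B.

Definition subset_mod_compact U V : Prop := compact (U `\` V).

Definition base_of_order_type F (kappa : cardinal) (U : kappa -> set T)
    : Prop :=
  filter_base F (range U) /\
  forall a b : kappa, ord_lt a b ->
    subset_mod_compact (U b) (U a) /\ ~ subset_mod_compact (U a) (U b).

End ClopenFilters.

(* Main.v *)
Require Import Defs.
From mathcomp Require Import all_boot.
From mathcomp Require Import boolp classical_sets functions cardinality.
From mathcomp Require Import topology cantor.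

Set Implicit Arguments.
Unset Strict Implicit.
Unset Printing Implicit Defensive.

Local Open Scope classical_set_scope.
Local Open Scope card_scope.

(** Write X for the product of nat and the Cantor space, with columns {n} x
    2^nat. Clopen subsets of X are compact exactly when they meet finitely many
    columns (bounded below), so the order modulo compact sets is inclusion up to
    finitely many columns. The basic clopen sets of X are countably many, so
    they are indexed by natural numbers.

    The base U_a, a < p, is built by recursion (remote_tower). At each stage it
    is enough to have a noncompact clopen W almost contained in all earlier
    sets. At a successor W is the previous set. At a limit stage, code U_b by
    the set E b of indices of basic sets contained in U_b; if each U_(b+1) is
    contained in U_b and misses one more column, then the family of the E b is
    directed by true inclusion, so being smaller than p it has a
    pseudointersection A, and the union of the basic sets with index in A is W
    (limit_stage). The family is small because it is indexed by the earlier
    stages themselves: later stages stand in for the finite modifications of the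
    sets U_b.

    The hypothesis p = cof(M) is used to make the filter remote. A nowhere dense
    N is described by a function phi such that basic (phi i) is contained in
    basic i and misses N. The combinatorial core (meager_prediction) attaches to
    each phi a meager set A phi, and to each meager set M a function psi, so
    that A phi `<=` M makes psi almost as good as phi: for almost all i, basic
    (psi i) is contained in basic i and misses N. Hence p many functions psi
    serve all nowhere dense sets. Stage a shrinks W, column by column, to sets
    of the form basic (psi_a i) (refine_clopen), so that U_a meets N in only
    finitely many columns, and intersecting with some U_b that misses these
    columns gives a member of the filter disjoint from N.

    For meager_prediction, A phi consists of the points x of the Baire space
    whose entries x n are, from some n on, different from a code of a long
    enough initial segment of phi, where long enough is determined by the
    preceding entries. A meager set M yields a point X cut into finite blocks
    such that every point agreeing with X on infinitely many blocks, and taking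
    prescribed alternative values elsewhere, escapes M (meager_block_escape). If
    infinitely many blocks of X contained no correct guess about phi, then
    copying these blocks and spoiling all other entries would give a point of A
    phi outside M. So almost every block contains a correct guess, and psi i is
    obtained by applying successively all the finite functions coded in the i-th
    block: a single correct one suffices, as the others can only shrink the
    basic set. *)

(** * Cylinders and nowhere dense sets *)

Definition cylinder (T : Type) (s : seq T) : set (nat -> T) :=
  [set x | mkseq x (size s) = s].

Lemma mkseq_cat (T : Type) (x : nat -> T) n m :
  mkseq x (n + m) = mkseq x n ++ mkseq (fun i => x (n + i)) m.
Proof.
by rewrite /mkseq iotaD map_cat add0n -[in iota n m](addn0 n) iotaDl -map_comp.
Qed.

Lemma cylinder_cat (T : Type) (s t : seq T) : cylinder (s ++ t) `<=` cylinder s.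
Proof.
move=> x; rewrite /cylinder /= size_cat mkseq_cat => /(congr1 (take (size s))).
by rewrite take_size_cat ?size_mkseq// take_size_cat.
Qed.

Lemma cylinder_nonempty (T : pointedType) (s : seq T) : cylinder s !=set0.
Proof. by exists (nth point s); rewrite /cylinder /= mkseq_nth. Qed.

Lemma clopen_cylinder (T : discreteTopologicalType) (s : seq T) :
  clopen (cylinder s : set (prod_topology (fun _ : nat => T))).
Proof.
elim/last_ind: s => [|s a IHs].
  suff -> : cylinder [::] = setT by exact: clopenT.
  by move=> U; rewrite eqEsubset.
have -> : cylinder (rcons s a) =
    cylinder s `&` (@mathcomp_extra.proj nat (fun=> T) (size s)) @^-1` [set a].
  rewrite eqEsubset; split=> x; rewrite /cylinder /= size_rcons mkseqS.
    by move=> /rcons_inj[-> <-].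
  by move=> [-> <-].
apply: clopenI => //; apply: preimage_clopen; last exact: proj_continuous.
by split; [exact: discrete_open|exact: discrete_closed].
Qed.

Lemma nbhs_cylinder (T : discreteTopologicalType)
    (x : prod_topology (fun _ : nat => T))
    (O : set (prod_topology (fun _ : nat => T))) :
  nbhs x O -> exists n, cylinder (mkseq x n) `<=` O.
Proof.
pose F := filter_from [set: nat] (fun n => cylinder (mkseq x n)).
have FF : Filter F.
  apply: filter_from_filter; first by exists 0.
  move=> i j _ _; exists (maxn i j) => //.
  have H k : (k <= maxn i j)%N ->
      cylinder (mkseq x (maxn i j)) `<=` cylinder (mkseq x k).
    by move=> /subnKC <-; rewrite mkseq_cat; exact: cylinder_cat.
  by move=> y yij; split; apply: H yij; rewrite (leq_maxl, leq_maxr).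
suff : F --> x by move=> Fx /Fx[n _ ?]; exists n.
apply/cvg_sup => i U.
have /= -> := @nbhsE (initial_topology (fun f : nat -> T => f i)) x.
move=> [B [[C oC <-] Bx] BU].
exists i.+1 => // y; rewrite /cylinder /mkset size_mkseq !mkseqS.
move=> /rcons_inj[_ yx].
by apply: BU; rewrite /= yx.
Qed.

Lemma nowhere_denseP (T : topologicalType) (N : set T) :
  nowhere_dense N <-> forall O, open O -> O !=set0 ->
    exists O', [/\ open O', O' !=set0, O' `<=` O & O' `&` N = set0].
Proof.
split=> [N0 O oO [x Ox]|H].
  have [z Oz Nz] : exists2 z, O z & ~ closure N z.
    apply: contrapT => /forall2NP H.
    have : interior (closure N) x.
      rewrite /interior nbhsE; exists O => // y Oy.
      by have [//|/contrapT] := H y.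
    by rewrite N0.
  exists (O `&` ~` closure N); split.
  - by apply: openI => //; apply: closed_openC; exact: closed_closure.
  - by exists z.
  - exact: subIsetl.
  - rewrite -subset0 => y [[_ Ny] Ny']; apply: Ny; exact: subset_closure.
rewrite /nowhere_dense -subset0 => x /=.
rewrite /interior nbhsE => -[O [oO Ox] ON].
have [|O' [oO' [y O'y] O'O O'N]] := H O oO; first by exists x.
have := ON _ (O'O _ O'y).
move=> /(_ O') []; first by apply: open_nbhs_nbhs.
by move=> z /= [Nz O'z]; have : (O' `&` N) z by []; rewrite O'N.
Qed.
(** * Escaping a meager set block by block *)

Lemma nowhere_dense_escape (N : set baire_space) (s : seq nat) :
  nowhere_dense N -> exists t, cylinder (s ++ t) `&` N = set0.
Proof.
move=> /nowhere_denseP /(_ (cylinder s)) [].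
- by have [] := @clopen_cylinder nat s.
- exact: cylinder_nonempty.
move=> O [oO [x Ox] Os ON].
have [n xO] := nbhs_cylinder (open_nbhs_nbhs (conj oO Ox)).
exists (mkseq (fun i => x (size s + i)) n).
rewrite -subset0 => y [ys Ny].
suff : (O `&` N) y by rewrite ON.
split=> //; apply: xO.
have := ys; rewrite -(Os _ Ox) size_mkseq -mkseq_cat addnC mkseq_cat.
exact: cylinder_cat.
Qed.

(** One extension t serves all pairs: it is prolonged once for each pair, and
    a prolongation keeps the escapes already obtained. *)
Lemma nowhere_dense_escape_finite (N : nat -> set baire_space)
    (r : seq (seq nat * nat)) :
  (forall j, nowhere_dense (N j)) ->
  exists t, forall v j, (v, j) \in r -> cylinder (v ++ t) `&` N j = set0.
Proof.
move=> Nnd; elim: r => [|[v j] r [t IHr]]; first by exists [::].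
have [u tu] := nowhere_dense_escape (v ++ t) (Nnd j).
exists (t ++ u) => v' j'; rewrite inE => /predU1P[[-> ->]|/IHr tN].
  by rewrite catA.
rewrite -subset0 => y [yt Ny]; rewrite -tN; split; last exact: Ny.
by move: yt; rewrite catA; exact: cylinder_cat.
Qed.

(** Any finite sequence can be prolonged by the value that the strategy g
    predicts, so the points that are off from a fixed index on form a nowhere
    dense set. *)
Lemma meager_eventually_off (g : seq nat -> nat) :
  meager [set x : baire_space |
    exists k, forall n, (k <= n)%N -> x n <> g (mkseq x n)].
Proof.
exists (fun k => [set x | forall n, (k <= n)%N -> x n <> g (mkseq x n)]); split.
  move=> k; apply/nowhere_denseP => O oO [x Ox].
  have [n xO] := nbhs_cylinder (open_nbhs_nbhs (conj oO Ox)).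
  pose s := mkseq x (n + k).
  exists (cylinder (rcons s (g s))); split.
  - by have [] := @clopen_cylinder nat (rcons s (g s)).
  - exact: cylinder_nonempty.
  - move=> y; rewrite -cats1 /s mkseq_cat -catA => /cylinder_cat; exact: xO.
  - rewrite -subset0 => y []; rewrite /cylinder /mkset size_rcons size_mkseq.
    rewrite mkseqS => /rcons_inj[ys yg] /(_ (n + k) (leq_addl _ _)).
    by rewrite ys.
rewrite eqEsubset; split=> x; first by move=> [k xk]; exists k.
by move=> [k _ xk]; exists k.
Qed.

(** The finitely many initial segments that a point may have when each of its
    entries is either that of a given point or its alternative. *)
Fixpoint variants (alt : nat -> nat) (s : seq nat) : seq (seq nat) :=
  if s is c :: s' then [seq a :: v | a <- [:: c; alt c], v <- variants alt s']
  else [:: [::]].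

Lemma mem_variants (alt X x : nat -> nat) (s : seq nat) :
  (forall i, x i = X i \/ x i = alt (X i)) ->
  map x s \in variants alt (map X s).
Proof.
move=> xX; elim: s => [|i s IHs]; first by rewrite inE.
apply: (@allpairs_f _ _ _ (fun a v => a :: v)) => //.
by rewrite !inE; have [->|->] := xX i; rewrite eqxx ?orbT.
Qed.

(** The n-th block of X is chosen so that, after any variant of what precedes,
    it leaves the first n + 1 nowhere dense sets that make up M. Since the
    variants are finite in number, a single block does it. A point that copies
    infinitely many blocks therefore leaves all of them. *)
Lemma meager_block_escape (M : set baire_space) (alt : nat -> nat) :
  meager M ->
  exists (X b : nat -> nat), [/\ forall n, (n <= b n)%N,
    forall n, (b n <= b n.+1)%N
    & forall x : baire_space, (forall i, x i = X i \/ x i = alt (X i)) ->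
      (forall m, exists2 n, (m <= n)%N &
        forall i, (b n <= i < b n.+1)%N -> x i = X i) ->
      ~ M x].
Proof.
move=> [N [Nnd ->]].
have /choice[ext extP] : forall ns : nat * seq nat, exists t, forall v j,
    v \in variants alt ns.2 -> (j <= ns.1)%N ->
    cylinder (v ++ t) `&` N j = set0.
  move=> [n s]; have [t tP] := nowhere_dense_escape_finite
    [seq (v, j) | v <- variants alt s, j <- iota 0 n.+1] Nnd.
  exists t => v j vs jn; apply: tP; apply: allpairs_f => //.
  by rewrite mem_iota.
(* The extra entry 0 makes every block nonempty, which gives n <= b n. *)
pose B := fix B n := if n is m.+1 then B m ++ rcons (ext (m, B m)) 0 else [::].
have BS n : B n.+1 = B n ++ rcons (ext (n, B n)) 0 by [].
have sBS n : (size (B n) < size (B n.+1))%N.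
  by rewrite BS size_cat size_rcons addnS ltnS leq_addr.
have sB n : (n <= size (B n))%N.
  by elim: n => // n IHn; exact: leq_ltn_trans IHn (sBS n).
have nthB m n i : (m <= n)%N -> (i < size (B m))%N ->
    nth 0 (B n) i = nth 0 (B m) i.
  move=> /subnKC <-; elim: (n - m)%N => [|k IHk] im; first by rewrite addn0.
  rewrite addnS BS nth_cat IHk//; case: ifPn => // /negP[].
  apply: leq_trans im _; elim: k {IHk} => [|k IHk]; first by rewrite addn0.
  by rewrite addnS; apply: leq_trans IHk _; exact: ltnW.
pose X i := nth 0 (B i.+1) i.
have BX n : B n = mkseq X (size (B n)).
  apply: (@eq_from_nth _ 0); rewrite ?size_mkseq// => i iB.
  rewrite nth_mkseq// /X; have [/nthB->//|/ltnW/nthB ->//] := leqP n i.+1.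
exists X, (fun n => size (B n)); split=> // [n|x xX xB [j _ Nx]].
  exact: ltnW.
have [n jn xn] := xB j.
have E : cylinder (mkseq x (size (B n)) ++ ext (n, B n)) `&` N j = set0.
  by apply: extP => //=; rewrite {2}(BX n); exact: mem_variants.
suff : (cylinder (mkseq x (size (B n)) ++ ext (n, B n)) `&` N j) x by rewrite E.
split; last exact: Nx.
have : cylinder (mkseq x (size (B n)) ++ rcons (ext (n, B n)) 0) x.
  rewrite /cylinder /mkset size_cat size_mkseq mkseq_cat; congr cat.
  apply: (@eq_from_nth _ 0); rewrite ?size_mkseq// => i iB.
  rewrite nth_mkseq// xn; last by rewrite leq_addr BS size_cat ltn_add2l.
  transitivity (nth 0 (B n.+1) (size (B n) + i)).
    rewrite (BX n.+1) nth_mkseq// BS size_cat ltn_add2l//.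
  by rewrite BS nth_cat ltnNge leq_addr addKn.
by rewrite -cats1 catA; exact: cylinder_cat.
Qed.
(** * Predicting shrinking functions *)

(** A value of a point of the Baire space codes a finite function, as the list
    of its values, together with a flag that is false when the value is a
    spoiled guess. *)
Definition entry (c : nat) : bool * seq nat := odflt (false, [::]) (unpickle c).

Lemma entry_pickle e : entry (pickle e) = e.
Proof. by rewrite /entry pickleK. Qed.

(** Spoiling the guess keeps the list: the bound below, hence the guesses made
    at later entries, are the same whether an entry is spoiled or not. *)
Definition junk (c : nat) : nat := pickle (false, (entry c).2).

(** Strictly above the length of s and all values of the functions coded in s:
    a point less than the length of a prefix of s stays below this bound when it
    is moved by the functions coded in the rest of s. *)
Definition bound (s : seq nat) : nat :=
  (size s + \sum_(c <- s) sumn (entry c).2).+1.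

Definition guess (phi : nat -> nat) (s : seq nat) : nat :=
  pickle (true, mkseq phi (bound s)).

Lemma bound_map (X x : nat -> nat) (s : seq nat) :
  (forall i, (entry (x i)).2 = (entry (X i)).2) ->
  bound (map x s) = bound (map X s).
Proof.
move=> xX; rewrite /bound !size_map !big_map.
by congr (_ + _).+1; apply: eq_bigr => i _; rewrite xX.
Qed.

Lemma nth_leq_sumn (s : seq nat) (j : nat) :
  (nth j s j <= maxn j (sumn s))%N.
Proof.
have [js|sj] := ltnP j (size s); last by rewrite nth_default// leq_maxl.
rewrite leq_max; apply/orP; right.
move: {1}j => d; elim: s j js => // a s IHs [|k] /= ks; first exact: leq_addr.
by apply: leq_trans (IHs _ ks) _; exact: leq_addl.
Qed.

(** A wrong guess may be anything, so it is followed only when it goes down for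
    the preorder r. The default value j of the list means that j stays fixed
    outside the domain. *)
Definition apply_entry (r : nat -> nat -> Prop) (j c : nat) : nat :=
  let v := nth j (entry c).2 j in if `[< r v j >] then v else j.

Lemma foldl_apply_entry_lt r (t s : seq nat) (j : nat) :
  (j < bound s)%N -> (foldl (apply_entry r) j t < bound (s ++ t))%N.
Proof.
elim: t s j => [|c t IHt] s j js /=; first by rewrite cats0.
rewrite -cat_rcons; apply: IHt.
have H : (bound s + sumn (entry c).2 < bound (rcons s c))%N.
  rewrite /bound -cats1 size_cat big_cat big_seq1 /=.
  by rewrite addSn addn1 addSn addnA ltnSn.
apply: leq_ltn_trans H; rewrite /apply_entry; case: ifP => _.
  apply: leq_trans (nth_leq_sumn _ _) _; rewrite geq_max leq_addl andbT.
  by rewrite (leq_trans (ltnW js))// leq_addr.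
by rewrite (leq_trans (ltnW js))// leq_addr.
Qed.

Lemma foldl_apply_entry_le (r : nat -> nat -> Prop) (t : seq nat) (j : nat) :
  (forall i, r i i) -> (forall i j k, r i j -> r j k -> r i k) ->
  r (foldl (apply_entry r) j t) j.
Proof.
move=> rr rt; elim: t j => //= c t IHt j; apply: rt (IHt _) _.
by rewrite /apply_entry; case: ifPn => // /asboolP.
Qed.

(** When r j i is inclusion of the j-th basic set in the i-th, this is a Tukey
    reduction: finding a psi that refines phi at almost every index reduces to
    finding a meager set that contains A phi. *)
Lemma meager_prediction (r : nat -> nat -> Prop)
    (rr : forall i, r i i) (rt : forall i j k, r i j -> r j k -> r i k) :
  exists A : (nat -> nat) -> set baire_space, (forall phi, meager (A phi)) /\
  forall M, meager M -> exists psi : nat -> nat, (forall i, r (psi i) i) /\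
    forall phi : nat -> nat, (forall i, r (phi i) i) -> A phi `<=` M ->
    exists k, forall i, (k <= i)%N -> exists2 j, r j i & r (psi i) (phi j).
Proof.
exists (fun phi => [set x : baire_space |
  exists k, forall n, (k <= n)%N -> x n <> guess phi (mkseq x n)]); split.
  by move=> phi; exact: meager_eventually_off.
move=> M /(meager_block_escape junk)[X [b [nb bS escape]]].
pose block n := mkseq (fun t => X (b n + t)) (b n.+1 - b n).
exists (fun i => foldl (apply_entry r) i (block i)); split.
  by move=> i; exact: foldl_apply_entry_le.
move=> phi phir AM; apply: contrapT => /forallNP bad.
pose wrong n := forall p, (b n <= p < b n.+1)%N -> X p <> guess phi (mkseq X p).
(* A correct guess at p in the i-th block is defined at the index j reached
   from i before p, as j is below the bound of the entries before p. *)
have {}bad m : exists2 n, (m <= n)%N & wrong n.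
  have := bad m; apply: contra_notP => /forall2NP wr i mi.
  have [//|/existsNP[p /not_implyP[/andP[bp pb] /contrapT Xp]]] := wr i.
  pose s := mkseq (fun t => X (b i + t)) (p - b i).
  have pE : mkseq X p = mkseq X (b i) ++ s by rewrite -mkseq_cat subnKC.
  have [t blockE] : exists t, block i = s ++ X p :: t.
    exists (mkseq (fun t => X (b i + (p - b i + t.+1))) (b i.+1 - p).-1).
    rewrite /block.
    have -> : (b i.+1 - b i = (p - b i) + (b i.+1 - p).-1.+1)%N.
      by rewrite prednK ?subn_gt0// addnC addnBA// subnK// ltnW.
    rewrite mkseq_cat; congr cat.
    rewrite -[(_.-1).+1]add1n mkseq_cat /= addn0 subnKC//.
  exists (foldl (apply_entry r) i s); first exact: foldl_apply_entry_le.
  rewrite blockE foldl_cat /=; set j := foldl _ i s.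
  suff -> : apply_entry r j (X p) = phi j by exact: foldl_apply_entry_le.
  have jb : (j < bound (mkseq X p))%N.
    rewrite pE; apply: foldl_apply_entry_lt.
    by rewrite /bound size_mkseq ltnS (leq_trans (nb i))// leq_addr.
  by rewrite /apply_entry Xp entry_pickle /= nth_mkseq// asboolT.
(* Copying the wrong blocks and spoiling all other entries leaves no correct
   guess, although infinitely many blocks are copied. *)
pose x : baire_space := fun p =>
  if `[< exists n, wrong n /\ (b n <= p < b n.+1)%N >] then X p else junk (X p).
have xX p : x p = X p \/ x p = junk (X p).
  by rewrite /x; case: ifP => _; [left|right].
apply: (escape x xX).
  move=> m; have [n mn wn] := bad m; exists n => // i ib.
  by rewrite /x asboolT//; exists n.
apply: AM; exists 0 => n _.
have -> : guess phi (mkseq x n) = guess phi (mkseq X n).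
  rewrite /guess /mkseq (@bound_map X)// => i.
  by have [->|->] := xX i; rewrite // entry_pickle.
rewrite /x; case: asboolP => [[m [wm nm]]|_]; first exact: wm.
by move=> /(congr1 entry); rewrite !entry_pickle.
Qed.
(** * Ordinals below a cardinal *)

Lemma ord_min (kappa : cardinal) (P : kappa -> Prop) :
  (exists a, P a) -> exists2 a, P a & forall b, P b -> ord_le a b.
Proof.
move=> [a Pa].
have [|m [[Pm mP] _]] := @ord_le_wo kappa (fun b => `[< P b >]).
  by exists a; exact/asboolP.
by exists m; [exact/asboolP|move=> b Pb; apply: mP; exact/asboolP].
Qed.

Lemma ord_le_total (kappa : cardinal) (a b : kappa) : ord_le a b \/ ord_le b a.
Proof.
have [|m [->|->] mP] := @ord_min kappa (fun c => c = a \/ c = b).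
- by exists a; left.
- by left; apply: mP; right.
- by right; apply: mP; left.
Qed.

Lemma ord_le_refl (kappa : cardinal) (a : kappa) : ord_le a a.
Proof. by have [] := ord_le_total a a. Qed.

Lemma ord_le_anti (kappa : cardinal) (a b : kappa) :
  ord_le a b -> ord_le b a -> a = b.
Proof.
move=> ab ba.
have [|m [_ mU]] := @ord_le_wo kappa (fun c => `[< c = a \/ c = b >]).
  by exists a; apply/asboolP; left.
rewrite -(mU a); last first.
  split; first by apply/asboolP; left.
  by move=> c /asboolP[->|->//]; exact: ord_le_refl.
apply: mU; split; first by apply/asboolP; right.
by move=> c /asboolP[->//|->]; exact: ord_le_refl.
Qed.

Lemma ord_ltNge (kappa : cardinal) (a b : kappa) : ord_lt a b <-> ~ ord_le b a.
Proof. by split=> [/negP|/negP]. Qed.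

Lemma ord_ltgt (kappa : cardinal) (a b : kappa) :
  [\/ ord_lt a b, a = b | ord_lt b a].
Proof.
have [ab|/ord_ltNge] := pselect (ord_le a b); last by constructor 3.
have [ba|/ord_ltNge] := pselect (ord_le b a); last by constructor 1.
by constructor 2; exact: ord_le_anti.
Qed.

Lemma ord_lt_wf (kappa : cardinal) : well_founded (@ord_lt kappa).
Proof.
move=> a; apply: contrapT => aA.
have [|m mA mP] := @ord_min kappa (fun b => ~ Acc (@ord_lt kappa) b).
  by exists a.
apply: mA; constructor=> b bm; apply: contrapT => /mP mb.
by move/ord_ltNge: bm.
Qed.

Definition ord_succ (kappa : cardinal) (a s : kappa) : Prop :=
  ord_lt a s /\ forall b, ord_lt b s -> ord_le b a.

Lemma ord_succ_exists (kappa : cardinal) (a b : kappa) :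
  ord_lt a b -> exists2 s, ord_succ a s & ord_le s b.
Proof.
move=> ab; have [|s as_ sP] := @ord_min kappa (ord_lt a); first by exists b.
exists s; last exact: sP.
split=> // c /ord_ltNge cs; apply: contrapT => /ord_ltNge; move/sP; exact: cs.
Qed.

(** Recursive choice: the stage a is specified relative to a total function f of
    which, by the extensionality hypothesis on P, only the values below a
    matter. *)
Lemma wf_choice (I T : Type) (lt : I -> I -> Prop) (t0 : T)
    (P : I -> (I -> T) -> T -> Prop) :
  well_founded lt ->
  (forall a f g t, (forall b, lt b a -> f b = g b) -> P a f t -> P a g t) ->
  (forall a f, (forall b, lt b a -> P b f (f b)) -> exists t, P a f t) ->
  exists f, forall a, P a f (f a).
Proof.
move=> wf Pext Pex.
pose tot a (f : forall b, lt b a -> T) b :=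
  if pselect (lt b a) is left h then f b h else t0.
pose step a f := if pselect (exists t, P a (tot a f) t) is left h
  then projT1 (cid h) else t0.
pose f := Fix wf (fun=> T) step.
have fE a : f a = step a (fun b _ => f b).
  rewrite /f Fix_eq// => b g h gh; congr step.
  by apply: functional_extensionality_dep => c;
    apply: functional_extensionality_dep => d.
have fP a : (exists t, P a f t) -> P a f (f a).
  move=> [t Pt]; rewrite [X in P _ _ X]fE /step.
  have E b : lt b a -> f b = tot a (fun b _ => f b) b.
    by move=> ba; rewrite /tot; case: pselect.
  case: pselect => [h|[]]; last by exists t; exact: Pext Pt.
  by apply: Pext (projT2 (cid h)) => b /E.
exists f => a; elim/(well_founded_ind wf): a => a IH.
by apply: fP; apply: Pex.
Qed.

(** * The pseudointersection number *)

Lemma centered2 (G : set (set nat)) (A B : set nat) :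
  centered G -> G A -> G B -> exists2 C, G C & C `<=` A `&` B.
Proof.
move=> cG GA GB.
have [[|i] _|C GC CAB] := cG 1 (fun i => if i == 0 then A else B).
- by [].
- by [].
by exists C => // n /CAB H; split; [exact: (H 0)|exact: (H 1)].
Qed.

(** The family of the E b with b below a has at most as many members as a proper
    initial segment of p, so the minimality of p applies to it. *)
Lemma initial_pseudointersection (p : cardinal) (a : p) (E : p -> set nat) :
  is_pseudointersection_number p ->
  (forall b, ord_lt b a -> infinite_set (E b)) ->
  (forall b c, ord_lt b a -> ord_lt c a ->
    exists2 d, ord_lt d a & E d `<=` E b `&` E c) ->
  exists2 A, infinite_set A & forall b, ord_lt b a -> finite_set (A `\` E b).
Proof.
move=> [_ pmin] Einf Edir; apply: contrapT => noA.
apply: (@ord_le_initial p a).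
apply: card_le_trans (card_image_le E [set b | ord_lt b a]).
apply: pmin; split.
- by move=> _ [b ba <-]; exact: Einf.
- move=> n g; elim: n => [|n IHn] gE.
    exists (g 0); first exact: gE.
    by move=> k gk i /=; rewrite leqn0 => /eqP ->.
  have [i iltn|_ [b ba <-] Eb] := IHn; first by apply: gE; exact: leqW.
  have [//|c ca Ec] := gE n.+1.
  have [d da dbc] := Edir b c ba ca.
  exists (E d); first by exists d.
  move=> k /dbc[/Eb kb]; rewrite Ec => kc i /=.
  by rewrite leq_eqVlt => /orP[/eqP->//|]; exact: kb.
- move=> [A [Ainf AE]]; apply: noA; exists A => // b ba.
  by apply: AE; exists b.
Qed.

Lemma pseudointersection_number_inhabited (p : cardinal) :
  is_pseudointersection_number p -> inhabited p.
Proof.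
move=> [[G [_ _ noA] Gp] _]; apply: contrapT => p0.
apply: noA; exists setT; split; first exact: infinite_nat.
have p0' : [set: p] = set0 by rewrite -subset0 => a _; apply: p0; constructor.
by move: Gp; rewrite p0' card_eq0 => /eqP -> ? [].
Qed.

(** A directed family G without pseudointersection has no least member, so if G
    is indexed by p and f a is the set indexed by a maximum a of p, some member
    A0 of G is a proper subset of f a. The members of G below A0 are still a
    directed family without pseudointersection, yet f a is not among them: they
    are indexed by a proper initial segment of p. *)
Lemma pseudointersection_number_nomax (p : cardinal) (a : p) :
  is_pseudointersection_number p -> exists b, ord_lt a b.
Proof.
move=> [[G [Ginf Gcen noA] Gp] pmin]; apply: contrapT => /forallNP amax.
have /card_set_bijP[f [fG _ fsurj]] : [set: p] #= G by rewrite card_eq_sym.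
have [[A0 GA0 [A0a A0n]]|noA0] := pselect
    (exists2 A, G A & A `<=` f a /\ A <> f a); last first.
  apply: noA; exists (f a); split; first by apply: Ginf; exact: fG.
  move=> B GB; have [C GC CAB] := centered2 Gcen (fG a I) GB.
  have [|Cn] := pselect (C = f a); last first.
    by exfalso; apply: noA0; exists C => //; split=> // x /CAB[].
  move=> Ca; rewrite (_ : _ `\` _ = set0)//.
  rewrite -subset0 => x [fx Bx]; apply: Bx; rewrite -Ca in fx.
  by have [] := CAB x fx.
apply: (@ord_le_initial p a).
apply: card_le_trans (card_image_le f [set b | ord_lt b a]).
apply: (@card_le_trans _ _ _ [set A | G A /\ A `<=` A0]); last first.
  apply: subset_card_le => A [GA AA0].
  have [b _ bA] := fsurj A GA; exists b => //.
  have [//|ba|/amax//] := ord_ltgt b a.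
  by exfalso; apply: A0n; rewrite eqEsubset; split=> //; rewrite -ba bA.
apply: pmin; split.
- by move=> A [/Ginf].
- move=> n g gG; have [i /gG[]//|A GA Ag] := Gcen n g.
  have [C GC CA] := centered2 Gcen GA GA0.
  exists C; first by split=> // x /CA[].
  by move=> x /CA[/Ag].
- move=> [A [Ainf AG]]; apply: noA; exists A; split=> // B GB.
  have [C GC CB] := centered2 Gcen GB GA0.
  apply: sub_finite_set (AG C _); last by split=> // x /CB[].
  by move=> x [Ax Bx]; split=> // /CB[].
Qed.
(** * Basic clopen sets and bounded sets of columns *)

Definition decode (i : nat) : nat * seq bool := odflt (0, [::]) (unpickle i).

Definition basic (i : nat) : set (nat * cantor_space) :=
  [set z | z.1 = (decode i).1 /\ cylinder (decode i).2 z.2].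

Definition bounded (U : set (nat * cantor_space)) : Prop :=
  exists m, forall z, U z -> (z.1 < m)%N.

Lemma basic_pickle n s z :
  basic (pickle (n, s)) z <-> z.1 = n /\ cylinder s z.2.
Proof. by rewrite /basic /decode /= pickleK. Qed.

Lemma basic_nonempty i : basic i !=set0.
Proof.
have [x xs] := @cylinder_nonempty bool (decode i).2.
by exists ((decode i).1, x).
Qed.

Lemma clopen_column (n : nat) : clopen [set z : nat * cantor_space | z.1 = n].
Proof.
apply: (@preimage_clopen _ _ fst [set n]); last by move=> z; exact: cvg_fst.
by split; [exact: discrete_open|exact: discrete_closed].
Qed.

Lemma clopen_basic i : clopen (basic i).
Proof.
apply: clopenI; first exact: clopen_column.
apply: (@preimage_clopen (nat * cantor_space)%type cantor_space snd
  (cylinder (decode i).2)).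
  exact: (@clopen_cylinder bool).
by move=> z; exact: cvg_snd.
Qed.

Lemma nbhs_basic z O : nbhs z O -> exists2 i, basic i z & basic i `<=` O.
Proof.
move=> [[P Q] /= [Pz Qz] PQO].
have [k kQ] := @nbhs_cylinder bool z.2 Q Qz.
exists (pickle (z.1, mkseq z.2 k)).
  by apply/basic_pickle; rewrite /cylinder /mkset size_mkseq.
move=> y /basic_pickle[yz /kQ yQ]; apply: PQO; split=> //=.
by rewrite yz; exact: nbhs_singleton.
Qed.

(** The columns are open, so being open, or clopen, may be checked in each
    column separately. *)
Lemma open_columns (U : set (nat * cantor_space)) :
  (forall n, exists2 V, open V & forall x, U (n, x) <-> V (n, x)) -> open U.
Proof.
move=> UV; rewrite openE => -[n x] Unx; have [V oV E] := UV n.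
apply: (@filterS _ _ _ (V `&` [set z | z.1 = n])).
  by move=> [k y] /= [Vky kn]; move: Vky; rewrite kn => /E.
apply: open_nbhs_nbhs; split; last by split=> //; exact/E.
by apply: openI => //; case: (clopen_column n).
Qed.

Lemma clopen_columns (U : set (nat * cantor_space)) :
  (forall n, exists2 V, clopen V & forall x, U (n, x) <-> V (n, x)) -> clopen U.
Proof.
move=> UV; split.
  by apply: open_columns => n; have [V [oV _] E] := UV n; exists V.
rewrite -openC; apply: open_columns => n; have [V [_ cV] E] := UV n.
exists (~` V); first exact: closed_openC.
by move=> x; split=> H /E.
Qed.

Lemma bounded_subset U V : U `<=` V -> bounded V -> bounded U.
Proof. by move=> UV [m mV]; exists m => z /UV /mV. Qed.

Lemma bounded_setU U V : bounded U -> bounded V -> bounded (U `|` V).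
Proof.
move=> [m mU] [n nV]; exists (maxn m n) => z [/mU|/nV] H.
  exact: leq_trans H (leq_maxl _ _).
exact: leq_trans H (leq_maxr _ _).
Qed.

Lemma unbounded_ge U m : ~ bounded U -> exists2 z, U z & (m <= z.1)%N.
Proof.
apply: contra_notP => /forall2NP H; exists m => z Uz.
by have [//|/negP] := H z; rewrite -ltnNge.
Qed.

Lemma compact_bounded U : compact U -> bounded U.
Proof.
move/compact_near_coveringP => /(_ nat \oo (fun m z => (z.1 < m)%N) _) [].
  move=> z _; exists ([set y | y.1 = z.1], [set m | (z.1 < m)%N]).
    split=> /=.
      apply: open_nbhs_nbhs; split=> //.
      by case: (clopen_column z.1).
    by exists z.1.+1.
  by move=> [y m] /= [-> ].
by move=> m _ mU; exists m => z; apply: (mU m) => /=.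
Qed.

Lemma bounded_compact U : closed U -> bounded U -> compact U.
Proof.
move=> cU [m mU].
apply: (@subclosed_compact _ _ (`I_m `*` [set: cantor_space])) => //.
  apply: compact_setX; last exact: cantor_space_compact.
  exact/finite_compact/finite_II.
by move=> z /mU.
Qed.

Lemma finite_set_ltn (A : set nat) (f : nat -> nat) :
  finite_set A -> exists m, forall i, A i -> (f i < m)%N.
Proof.
move=> /finite_seqP[s ->]; elim: s => [|a s [m IH]]; first by exists 0.
exists (maxn (f a).+1 m) => i /=; rewrite inE leq_max => /predU1P[->|/IH ->].
  by rewrite leqnn.
by rewrite orbT.
Qed.

Lemma sub_basic_column i j :
  basic i `<=` basic j -> (decode i).1 = (decode j).1.
Proof.
move=> ij; have [z zi] := basic_nonempty i.
by have [<- _] := ij z zi; case: zi.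
Qed.

Lemma basic_split i : exists l r, [/\ basic l `<=` basic i,
  basic r `<=` basic i & basic l `&` basic r = set0].
Proof.
case E: (decode i) => [n s].
have sub b : basic (pickle (n, rcons s b)) `<=` basic i.
  move=> z /basic_pickle[zn]; rewrite -cats1 => /cylinder_cat zs.
  by rewrite /basic E.
exists (pickle (n, rcons s true)), (pickle (n, rcons s false)).
split; [exact: sub|exact: sub|].
rewrite -subset0 => z [/basic_pickle[_ +] /basic_pickle[_]].
by rewrite /cylinder /mkset !size_rcons => -> /rcons_inj[].
Qed.

Lemma infinite_sub_basic (U : set (nat * cantor_space)) :
  open U -> ~ bounded U -> infinite_set [set i | basic i `<=` U].
Proof.
move=> oU Un /(finite_set_ltn (fun i => (decode i).1))[m mU].
have [z Uz mz] := unbounded_ge m Un.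
have [i iz iU] := nbhs_basic (open_nbhs_nbhs (conj oU Uz)).
have := mU i iU; have [<- _] := iz; by rewrite ltnNge mz.
Qed.

(** An infinite union of basic sets is closed because each column sees a finite
    union only. *)
Lemma column_finite_bigcup (A : set nat) :
  infinite_set A ->
  (forall m, finite_set [set i | A i /\ ((decode i).1 < m)%N]) ->
  clopen (\bigcup_(i in A) basic i) /\ ~ bounded (\bigcup_(i in A) basic i).
Proof.
move=> Ainf Afin; split; last first.
  move=> [m mA]; apply: Ainf; apply: sub_finite_set (Afin m).
  move=> i Ai; split=> //.
  by have [z zi] := basic_nonempty i; have [<- _] := zi; apply: mA; exists i.
apply: clopen_columns => n.
exists (\bigcup_(i in [set i | A i /\ ((decode i).1 < n.+1)%N]) basic i).
  split; first by apply: bigcup_open => i _; case: (clopen_basic i).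
  by apply: closed_bigcup => // i _; case: (clopen_basic i).
move=> x; split=> -[i]; last by move=> [Ai _] ix; exists i.
by move=> Ai ix; exists i => //; split=> //; have [<- _] := ix.
Qed.

Lemma nowhere_dense_basic (N : set (nat * cantor_space)) :
  nowhere_dense N -> exists phi : nat -> nat, forall i,
    basic (phi i) `<=` basic i /\ basic (phi i) `&` N = set0.
Proof.
move=> /nowhere_denseP Nnd.
suff /choice[phi phiP] : forall i, exists j,
  basic j `<=` basic i /\ basic j `&` N = set0 by exists phi.
move=> i; have [||O [oO [x Ox] Oi ON]] := Nnd (basic i).
- by case: (clopen_basic i).
- exact: basic_nonempty.
have [j _ jO] := nbhs_basic (open_nbhs_nbhs (conj oO Ox)).
exists j; split; first by apply: subset_trans Oi.
by rewrite -subset0 => y [/jO Oy Ny]; rewrite -ON.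
Qed.
(** In each column n >= m that W meets, fix two disjoint basic sets inside W.
    The first one, shrunk by psi, is the part of U in that column; the second
    one stays in the difference of W and U, which makes U strictly smaller
    modulo compact sets. One basic set per column is what bounds U `&` N: only
    finitely many columns use an index below k. *)
Lemma refine_clopen (W : set (nat * cantor_space)) (psi : nat -> nat)
    (m : nat) :
  clopen W -> ~ bounded W -> (forall i, basic (psi i) `<=` basic i) ->
  exists U, [/\ clopen U, ~ bounded U,
    U `<=` W `&` [set z | (m <= z.1)%N], ~ bounded (W `\` U)
    & forall N k, (forall i, (k <= i)%N -> basic (psi i) `&` N = set0) ->
        bounded (U `&` N)].
Proof.
move=> [oW _] Wn psiP.
have /choice[c cP] : forall n, exists lr : nat * nat, (exists x, W (n, x)) ->
    [/\ (decode lr.1).1 = n, (decode lr.2).1 = n, basic lr.1 `<=` W,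
        basic lr.2 `<=` W & basic lr.1 `&` basic lr.2 = set0].
  move=> n; have [[x Wnx]|nW] := pselect (exists x, W (n, x)); last first.
    by exists (0, 0).
  have [i inx iW] := nbhs_basic (open_nbhs_nbhs (conj oW Wnx)).
  have [l [r [li ri lr0]]] := basic_split i.
  have <- : (decode i).1 = n by case: inx.
  exists (l, r) => _; split=> //=; try exact: sub_basic_column.
    exact: subset_trans iW.
  exact: subset_trans iW.
pose U := [set z |
  [/\ (m <= z.1)%N, exists x, W (z.1, x) & basic (psi (c z.1).1) z]].
have Ul z : U z -> basic (c z.1).1 z by move=> [_ _ /psiP].
have UW : U `<=` W.
  by move=> z Uz; have [_ /cP[_ _ lW _ _] _] := Uz; exact/lW/Ul.
have Uge k : exists2 z, W z & (maxn m k <= z.1)%N := unbounded_ge _ Wn.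
have colE n i :
    (exists x, W (n, x)) -> basic i `<=` basic (c n).1 -> (decode i).1 = n.
  by move=> /cP[cn _ _ _ _] /sub_basic_column ->.
exists U; split.
- apply: clopen_columns => n.
  have [[mn nW]|nU] := pselect ((m <= n)%N /\ exists x, W (n, x)); last first.
    exists set0; first exact: clopen0.
    by move=> x; split=> // -[/= mn nW _]; apply: nU.
  exists (basic (psi (c n).1)); first exact: clopen_basic.
  by move=> x; split=> [[]|].
- move=> [k Uk]; have [[n x] Wnx] := Uge k; rewrite /= geq_max => /andP[mn kn].
  have nW : exists x, W (n, x) by exists x.
  have [[n' y] yn] := basic_nonempty (psi (c n).1).
  have nE : n' = n by have [/= -> _] := yn; exact: colE.
  rewrite nE in yn.
  have := Uk (n, y); rewrite ltnNge /= kn; move=> H; suff: false by [].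
  exact: H.
- by move=> z Uz; split; [exact: UW|have [] := Uz].
- move=> [k Uk]; have [[n x] Wnx] := Uge k; rewrite /= geq_max => /andP[mn kn].
  have nW : exists x, W (n, x) by exists x.
  have [_ rn _ rW lr0] := cP n nW.
  have [[n' y] yn] := basic_nonempty (c n).2.
  have nE : n' = n by have [/= -> _] := yn.
  rewrite nE in yn.
  have := Uk (n, y); rewrite ltnNge /= kn; move=> H; suff: false by [].
  apply: H; split; first exact: rW.
  by move=> /Ul /= ly; rewrite -[False]/(set0 (n, y)) -lr0.
- move=> N k kN.
  exists (\max_(i < k) (decode i).1).+1 => z [Uz Nz].
  have [_ zW zpsi] := Uz.
  have -> : z.1 = (decode (c z.1).1).1 by apply/esym/colE.
  have [ck|kc] := ltnP (c z.1).1 k.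
    by rewrite ltnS (@leq_bigmax _ (fun i : 'I_k => (decode i).1) (Ordinal ck)).
  by have : (basic (psi (c z.1).1) `&` N) z by []; rewrite kN.
Qed.
(** * The tower *)

(** The condition at a successor stage makes true inclusion available at limit
    stages: the tower is decreasing along finitely many successors, and each of
    them pushes the first column met further. *)
Definition tower_stage (p : cardinal) (psi : p -> nat -> nat) (a : p)
    (f : p -> set (nat * cantor_space)) (V : set (nat * cantor_space)) : Prop :=
  [/\ clopen V, ~ bounded V,
    forall b, ord_lt b a -> bounded (V `\` f b) /\ ~ bounded (f b `\` V),
    forall c, ord_succ c a -> V `<=` f c /\
      forall m, (forall z, f c z -> (m <= z.1)%N) ->
        forall z, V z -> (m < z.1)%N
    & forall N k, (forall i, (k <= i)%N -> basic (psi a i) `&` N = set0) ->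
        bounded (V `&` N)].

(** The sets E b are directed by true inclusion: if f c is contained in f b
    outside the first m columns, then the m-th successor of c, which misses
    these columns, gives a set contained in both. For the same reason the
    pseudointersection A meets each column in a finite set of indices. *)
Lemma limit_stage (p : cardinal) (psi : p -> nat -> nat) (a : p)
    (f : p -> set (nat * cantor_space)) :
  is_pseudointersection_number p ->
  (exists b, ord_lt b a) -> ~ (exists c, ord_succ c a) ->
  (forall b, ord_lt b a -> tower_stage psi b f (f b)) ->
  exists W, [/\ clopen W, ~ bounded W
    & forall b, ord_lt b a -> bounded (W `\` f b)].
Proof.
move=> hp [b0 b0a] alim IH.
have far m c : ord_lt c a -> exists d, [/\ ord_lt d a, f d `<=` f c
    & forall z, f d z -> (m <= z.1)%N].
  move=> ca; elim: m => [|m [d [da dc dm]]]; first by exists c; split.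
  have [s ds sa] := ord_succ_exists da.
  have {}sa : ord_lt s a.
    apply/ord_ltNge => as_; apply: alim; exists d.
    by rewrite (ord_le_anti as_ sa).
  have [_ _ _ /(_ _ ds)[sd sm] _] := IH s sa.
  by exists s; split=> //; [exact: subset_trans dc|exact: sm].
pose E b := [set i | basic i `<=` f b].
have dir b c : ord_lt b a -> ord_lt c a ->
    exists2 d, ord_lt d a & E d `<=` E b `&` E c.
  have sub b' c' d : f d `<=` f b' `&` f c' -> E d `<=` E b' `&` E c'.
    by move=> dbc i id; split=> z /id /dbc[].
  have main b' c' : ord_lt b' c' -> ord_lt c' a ->
      exists2 d, ord_lt d a & f d `<=` f b' `&` f c'.
    move=> bc ca; have [_ _ /(_ _ bc)[[m mcb] _] _ _] := IH c' ca.
    have [d [da dc dm]] := far m c' ca.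
    exists d => // z dz; split; last exact: dc.
    apply: contrapT => nbz; have := mcb z (conj (dc z dz) nbz).
    by rewrite ltnNge dm.
  move=> ba ca; have [bc|->|cb] := ord_ltgt b c.
  - by have [d da dbc] := main b c bc ca; exists d => //; exact: sub.
  - by exists c => //; rewrite setIid.
  - have [d da dbc] := main c b cb ba; exists d => //.
    by rewrite setIC; exact: sub.
have Einf b : ord_lt b a -> infinite_set (E b).
  by move=> /IH[[ob _] bn _ _ _]; exact: infinite_sub_basic.
have [A Ainf AE] := initial_pseudointersection hp Einf dir.
have [m|cA nA] := @column_finite_bigcup A Ainf.
  have [d [da _ dm]] := far m b0 b0a.
  apply: sub_finite_set (AE d da) => i [Ai im]; split=> // id.
  have [z zi] := basic_nonempty i; have := dm z (id z zi).
  by have [-> _] := zi; rewrite leqNgt im.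
exists (\bigcup_(i in A) basic i); split=> // b ba.
have [m mA] := finite_set_ltn (fun i => (decode i).1) (AE b ba).
exists m => z [[i Ai zi] nbz]; have [-> _] := zi.
by apply: mA; split=> // ib; apply/nbz/ib.
Qed.

Lemma unboundedT : ~ bounded setT.
Proof. by move=> [m /(_ (m, point) I)] /=; rewrite ltnn. Qed.

Lemma remote_tower (p : cardinal) (psi : p -> nat -> nat) :
  is_pseudointersection_number p ->
  (forall a i, basic (psi a i) `<=` basic i) ->
  exists U : p -> set (nat * cantor_space), forall a, tower_stage psi a U (U a).
Proof.
move=> hp psiP.
apply: (@wf_choice _ _ (@ord_lt p) set0 (tower_stage psi)).
- exact: ord_lt_wf.
- move=> a f g V fg [cV nV Vf Vs VN]; split=> //.
    by move=> b ba; rewrite -fg//; exact: Vf.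
  by move=> c ca; rewrite -fg; [exact: Vs|case: ca].
move=> a f IH.
have [W [m [cW nW Wf Wm]]] : exists W m, [/\ clopen W, ~ bounded W,
    forall b, ord_lt b a -> bounded (W `\` f b)
    & forall c, ord_succ c a -> W `<=` f c /\
      forall k, (forall z, f c z -> (k <= z.1)%N) -> (k < m)%N].
  have [[c [ca cmax]]|alim] := pselect (exists c, ord_succ c a).
    have [cfc nfc fcb _ _] := IH c ca.
    have [z0 z0c _] := unbounded_ge 0 nfc.
    (* Missing the column of a point z0 of f c forces U to start later. *)
    exists (f c), z0.1.+1; split=> // [b ba|c' [c'a c'max]].
      have [bc|->|cb] := ord_ltgt b c.
      - by have [] := fcb b bc.
      - by exists 0 => z [].
      - by have := cmax b ba; move/ord_ltNge: cb.
    rewrite (ord_le_anti (cmax _ c'a) (c'max _ ca)).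
    by split=> // k /(_ _ z0c).
  have [exb|nob] := pselect (exists b, ord_lt b a).
    have [W [cW nW Wf]] := limit_stage hp exb alim IH.
    by exists W, 0; split=> // c ca; exfalso; apply: alim; exists c.
  exists setT, 0; split; [exact: clopenT|exact: unboundedT| |].
    by move=> b ba; exfalso; apply: nob; exists b.
  by move=> c ca; exfalso; apply: alim; exists c.
have [U [cU nU UW nWU UN]] := refine_clopen m cW nW (psiP a).
exists U; split=> //.
- move=> b ba; have Wb := Wf b ba; split.
    by apply: bounded_subset Wb => z [/UW[Wz _] nz].
  move=> bU; apply: nWU; apply: bounded_subset (bounded_setU Wb bU).
  by move=> z [Wz nUz]; have [fz|nfz] := pselect (f b z); [right|left].
- move=> c ca; have [Wc cm] := Wm c ca; split; first by move=> z /UW[/Wc].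
  by move=> k /cm km z /UW[_ /=]; exact: leq_trans.
Qed.

Lemma smallest_clopen_filter (T : topologicalType) (B : set (set T)) :
  (forall U, B U -> clopen U) ->
  clopen_filter (smallest (@clopen_filter T) B).
Proof.
move=> Bc; split.
- move=> U; apply; split=> //; split=> //; first exact: clopenT.
  by move=> V W; exact: clopenI.
- by move=> F [[]].
- move=> U V FU FV F FB; have [[_ _ FI _] _] := FB.
  by apply: FI; [exact: FU|exact: FV].
- move=> U V FU cV UV F FB; have [[_ _ _ FS] _] := FB.
  exact: (FS U) (FU F FB) cV UV.
Qed.

Theorem theorem3p7 (p cofM : cardinal)
    (hp : is_pseudointersection_number p) (hcof : is_cof_meager cofM)
    (hpcof : [set: p] #= [set: cofM]) :
  exists F : set (set (nat * cantor_space)%type),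
    remote_filter F /\
    exists U : p -> set (nat * cantor_space)%type, base_of_order_type F U.
Proof.
have [A [Ameager Apredict]] := @meager_prediction
  (fun j i => basic j `<=` basic i) (fun i => @subset_refl _ _)
  (fun i j k => @subset_trans _ _ _ _).
have [[G [Gmeager Gcof] GcofM] _] := hcof.
(* This enumeration of cofinally many meager sets is where p = cof(M) enters. *)
have /card_set_bijP[M [MG _ Msurj]] : [set: p] #= G.
  by apply: card_eq_trans hpcof _; rewrite card_eq_sym.
have /choice[psi psiP] : forall a, exists psi : nat -> nat,
    (forall i, basic (psi i) `<=` basic i) /\
    forall phi, (forall i, basic (phi i) `<=` basic i) -> A phi `<=` M a ->
    exists k, forall i, (k <= i)%N ->
      exists2 j, basic j `<=` basic i & basic (psi i) `<=` basic (phi j).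
  by move=> a; apply: Apredict; apply: Gmeager; exact: MG.
have [U Ustage] := remote_tower hp (fun a => (psiP a).1).
have Uclopen a : clopen (U a) by have [] := Ustage a.
have Ulim a : ~ bounded (U a) by have [] := Ustage a.
have Ulev a b : ord_lt b a -> bounded (U a `\` U b) /\ ~ bounded (U b `\` U a).
  by have [_ _ + _ _] := Ustage a; exact.
have Rclopen V : range U V -> clopen V by move=> [a _ <-].
exists (smallest (@clopen_filter _) (range U)); split; last first.
  exists U; split; first by split.
  move=> a b ab; have [Uba Uab] := Ulev _ _ ab; split.
    apply: bounded_compact => //; rewrite setDE; apply: closedI.
      by case: (Uclopen b).
    by apply: open_closedC; case: (Uclopen a).
  by move/compact_bounded.
have UF a : smallest (@clopen_filter _) (range U) (U a).
  by move=> F [_]; apply; exists a.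
have FF := smallest_clopen_filter Rclopen.
have [a0] := pseudointersection_number_inhabited hp.
split=> //.
  (* As U a is not bounded, the following filter, which contains the range of
     U, does not contain the empty set. *)
  move=> /(_ [set V | clopen V /\ exists a, bounded (U a `\` V)])[].
    split.
      split.
      - by move=> V [].
      - by split; [exact: clopenT|exists a0; exists 0 => z [_ /(_ I)]].
      - move=> V W [cV [a aV]] [cW [b bW]]; split; first exact: clopenI.
        have [c [ca cb]] : exists c,
            bounded (U c `\` U a) /\ bounded (U c `\` U b).
          have bd c : bounded (U c `\` U c) by exists 0 => z [].
          have [/Ulev[ab _]|ab|/Ulev[ab _]] := ord_ltgt a b.
          - by exists b.
          - by exists a; split=> //; rewrite ab.
          - by exists a.
        exists c; apply: bounded_subset (bounded_setU (bounded_setU ca aV)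
          (bounded_setU cb bW)) => z [cz nVW].
        have [Vz|nV] := pselect (V z).
          right; have [Ub|nUb] := pselect (U b z); [right|left]; split=> //.
          by move=> Wz; apply: nVW.
        by left; have [Ua|nUa] := pselect (U a z); [right|left].
      - move=> V W [cV [a aV]] cW VW; split=> //; exists a.
        by apply: bounded_subset aV => z [Uz nWz]; split=> // /VW.
    move=> V [a _ <-]; split; first exact: Uclopen.
    by exists a; exists 0 => z [].
  by move=> _ [a]; rewrite setD0; exact: Ulim.
move=> N Nnd.
have [phi phiP] := nowhere_dense_basic Nnd.
have [B GB AB] := Gcof _ (Ameager phi).
have [a _ aB] := Msurj B GB.
have [_ /(_ phi)[|| k kP]] := psiP a.
- by move=> i; have [] := phiP i.
- by rewrite aB.
have [_ _ _ _ /(_ N k)[|m mN]] := Ustage a.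
  move=> i /kP[j _ ij]; rewrite -subset0 => z [/ij zj Nz].
  by have [_ <-] := phiP j.
have [b bm] : exists b, forall z, U b z -> (m <= z.1)%N.
  elim: m {mN} => [|m [b bm]]; first by exists a0.
  have [c bc] := pseudointersection_number_nomax b hp.
  have [s bs _] := ord_succ_exists bc.
  have [_ _ _ /(_ b bs)[_ sm] _] := Ustage s.
  by exists s; exact: sm.
exists (U a `&` U b); first by have [_ _ FI _] := FF; exact: FI.
rewrite -subset0 => z [[az bz] Nz].
by have := mN z (conj az Nz); rewrite ltnNge bm.
Qed.
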